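(* Let $(X_k^{(i)})_{k\in\mathbb Z}$ and $(X_k^{(j)})_{k\in\mathbb Z}$ be independent stationary ergodic real-valued sequences with common marginal distribution function $F$ (the null hypothesis $H_0:\mu^{(i)}=\mu^{(j)}$, where $\mu^{(r)}$ is the marginal law of $X^{(r)}$). For $r\in\{i,j\}$ let $\hat\mu_n^{(r)}=\frac1n\sum_{k=1}^n\delta_{X_k^{(r)}}$ and $F_n^{(r)}(t)=\hat\mu_n^{(r)}((-\infty,t])$. Assume the joint convergence in distribution $$\Bigl(\sqrt n\,(F_n^{(i)}-F),\ \sqrt n\,(F_n^{(j)}-F)\Bigr)\to\bigl(G^{(i)},G^{(j)}\bigr)\quad\text{in }L^1(\mathbb R)\times L^1(\mathbb R),$$ where $(G^{(i)},G^{(j)})$ is centered Gaussian, $G^{(i)}$ and $G^{(j)}$ are independent copies of one another, and for all bounded measurable $f,g:\mathbb R\to\mathbb R$, $$\operatorname{Cov}\Bigl(\int f(t)G^{(r)}(t)\,dt,\int g(t)G^{(r)}(t)\,dt\Bigr)=\sum_{k\in\mathbb Z}\mathbb E\Bigl(\iint f(t)g(s)\bigl(\mathbf 1\{X^{(r)}_0\le t\}-F(t)\bigr)\bigl(\mathbf 1\{X^{(r)}_k\le s\}-F(s)\bigr)\,dt\,ds\Bigr).$$ Let $T_{ij,n}:=\sqrt n\,W_1(\hat\mu_n^{(i)},\hat\mu_n^{(j)})$, $Z_{ij}:=\int_{\mathbb R}|G^{(i)}(t)-G^{(j)}(t)|\,dt$, let $\alpha\in(0,1)$, let $q_{1-\alpha}^{(ij)}$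 be the $(1-\alpha)$-quantile of $Z_{ij}$, and assume $\mathbb P(Z_{ij}=q_{1-\alpha}^{(ij)})=0$. Then the test rejecting $H_0$ whenever $T_{ij,n}>q_{1-\alpha}^{(ij)}$ has asymptotic level $\alpha$: $$\lim_{n\to\infty}\mathbb P_{H_0}\bigl(T_{ij,n}>q_{1-\alpha}^{(ij)}\bigr)=\alpha.$$
   Context: $W_1$ is the 1-Wasserstein distance between probability measures on $\mathbb R$, equal to $\int_{\mathbb R}|F_{\nu_1}(t)-F_{\nu_2}(t)|\,dt$; $\delta_x$ is the Dirac measure at $x$; $L^1(\mathbb R)$ is taken with respect to Lebesgue measure. The $(1-\alpha)$-quantile of a real random variable $Z$ is $\inf\{x\in\mathbb R:\mathbb P(Z\le x)\ge1-\alpha\}$. $\mathbb P_{H_0}$ is probability under $H_0$. *)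

(* Defs.v *)
From HB Require Import structures.
From mathcomp Require Import all_boot all_order all_algebra.
From mathcomp Require Import all_classical all_reals all_analysis.

Set Implicit Arguments.
Unset Strict Implicit.
Unset Printing Implicit Defensive.

Import Order.TTheory GRing.Theory Num.Theory.
Import numFieldNormedType.Exports.

Local Open Scope classical_set_scope.
Local Open Scope ring_scope.

(* The library's [LfunType mu p1] is the space of p-integrable functions, not
   quotiented by almost everywhere equality. It is topologized here by the
   pseudometric ||f - g||_p. Its open sets, Borel sets and continuous functions
   are the inverse images of those of the quotient L^p, so that statements
   about Borel laws, convergence in distribution or continuous linear
   functionals mean the same on either space. *)
Module LfunPseudoMetric.
Section pseudometric.
Context d (T : measurableType d) (R : realType).
Variables (mu : {measure set T -> \bar R}) (p : \bar R) (p1 : (1 <= p)%E).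

Notation L := (LfunType mu p1).

Definition Ldist (f g : L) : R := fine ('N[mu]_p[EFin \o (f - g)%R])%E.

Definition ball (f : L) (r : R) : set L := [set g | Ldist f g < r].

Definition ent : set_system (L * L) := entourage_ ball.

Definition nbhs (f : L) : set_system L := nbhs_ ent f.

#[export] HB.instance Definition _ := hasNbhs.Build L nbhs.

Lemma ball_center f (e : R) : 0 < e -> ball f e f.
Proof.
rewrite /ball/= /Ldist subrr (_ : EFin \o _ = cst 0%E)//.
by rewrite Lnorm0// gt_eqF// (lt_le_trans _ p1).
Qed.

Lemma ball_sym f g (e : R) : ball f e g -> ball g e f.
Proof.
rewrite /ball/= /Ldist -(LnormrN (g - f)).
by rewrite -(opprB g f).
Qed.

Lemma ball_triangle f g h e1 e2 : ball f e1 g -> ball g e2 h ->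
  ball f (e1 + e2) h.
Proof.
rewrite /ball/= /Ldist => fg gh.
rewrite -[f](subrK g) -addrA.
by rewrite (le_lt_trans (ler_LnormD _ _))// ltrD.
Qed.

#[export] HB.instance Definition _ := isPointed.Build L 0.

#[export] HB.instance Definition _ := @Nbhs_isPseudoMetric.Build R L
  ent erefl ball ball_center ball_sym ball_triangle erefl.

End pseudometric.
Module Exports. HB.reexport. End Exports.
End LfunPseudoMetric.
Export LfunPseudoMetric.Exports.

Definition L1 (R : realType) := LfunType (@lebesgue_measure R) (@lexx _ _ 1%E).

HB.instance Definition _ (R : realType) := PseudoPointedMetric.copy (L1 R)
  (LfunType (@lebesgue_measure R) (@lexx _ _ 1%E)).
HB.instance Definition _ (R : realType) := GRing.Lmodule.on (L1 R).

(* Makes the library's pointed and topological structures on products join. *)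
HB.instance Definition _ (S S' : ptopologicalType) := Pointed.on (S * S')%type.

Definition borel (S : ptopologicalType) := g_sigma_algebraType (@open S).

HB.instance Definition _ (S : ptopologicalType) := Measurable.on (borel S).

Section random_elements.
Context d (T : measurableType d) (R : realType) (P : probability T R).

Definition independent_elements d1 d2 (T1 : measurableType d1)
    (T2 : measurableType d2) (X : T -> T1) (Y : T -> T2) :=
  forall A B, measurable A -> measurable B ->
    (P (X @^-1` A `&` Y @^-1` B) = P (X @^-1` A) * P (Y @^-1` B))%E.

Definition identically_distributed d1 (T1 : measurableType d1)
    (X Y : T -> T1) :=
  forall A, measurable A -> P (X @^-1` A) = P (Y @^-1` A).

Definition cvg_in_distribution d' (T' : measurableType d')
    (P' : probability T' R) (S : ptopologicalType)
    (X : nat -> {RV P >-> borel S}) (Y : {RV P' >-> borel S}) :=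
  forall h : S -> R, continuous h -> (exists M, forall x, `|h x| <= M) ->
    ('E_P[h \o X n])%E @[n --> \oo] --> ('E_P'[h \o Y])%E.

Definition quantile (Z : T -> R) (p : R) : R :=
  inf [set x | (p%:E <= P [set w | (Z w <= x)%R])%E].

End random_elements.

Section sequences.
Context d (T : measurableType d) (R : realType) (P : probability T R).

Definition coordinate_sets : set (set (int -> R)) :=
  \bigcup_k preimage_set_system setT (fun x : int -> R => x k) measurable.

Definition seq_space := g_sigma_algebraType coordinate_sets.

HB.instance Definition _ := Measurable.on seq_space.

Definition seq_shift (x : seq_space) : seq_space := fun k => x (k + 1).

Definition trajectory (X : int -> T -> R) (w : T) : seq_space := X^~ w.

Definition stationary (X : int -> T -> R) :=
  forall A, measurable A ->
    P (trajectory X @^-1` (seq_shift @^-1` A)) = P (trajectory X @^-1` A).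

Definition ergodic (X : int -> T -> R) :=
  forall A, measurable A -> seq_shift @^-1` A = A ->
    P (trajectory X @^-1` A) = 0%E \/ P (trajectory X @^-1` A) = 1%E.

(* For n = 0 this is the null measure. *)
Definition empirical_measure (X : int -> T -> R) (n : nat) (w : T)
    : {measure set R -> \bar R} :=
  mscale (n%:R^-1)%:nng (msum (fun k => \d_(X k.+1%:Z w)) n).

Definition empirical_cdf (X : int -> T -> R) (n : nat) (w : T) (t : R) : R :=
  fine (empirical_measure X n w `]-oo, t]%classic).

End sequences.

Section wasserstein.
Context (R : realType).
Local Open Scope ereal_scope.

Definition couplings (mu nu : {measure set R -> \bar R})
    : set (probability (R * R)%type R) :=
  [set pi | forall A, measurable A ->
     pi (fst @^-1` A) = mu A /\ pi (snd @^-1` A) = nu A].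

Definition W1 (mu nu : {measure set R -> \bar R}) : \bar R :=
  ereal_inf [set \int[pi]_z `|z.1 - z.2|%:E | pi in couplings mu nu].

End wasserstein.

Section limit_process.
Context d (T : measurableType d) (R : realType) (P : probability T R).

(* The library's [normal_prob 0 s] is not the Dirac measure at 0 for s = 0. *)
Definition centered_normal (s : R) (A : set R) : \bar R :=
  if s == 0 then \d_(0 : R) A else normal_prob 0 s A.

Definition centered_gaussian (G : T -> L1 R * L1 R) :=
  forall l : {linear (L1 R * L1 R)%type -> R^o}, continuous l ->
    exists s : R, forall A, measurable A ->
      P ((l \o G) @^-1` A) = centered_normal s A.

Definition bounded_measurable (f : R -> R) :=
  measurable_fun setT f /\ exists M, forall t, `|f t| <= M.

(* All integrals and the sum are extended real numbers, and the covariance of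
   the Gaussian variables is finite: the convergence thus includes that each
   summand is a well-defined finite expectation. The sum over the integers is
   the limit of its symmetric partial sums. *)
Definition has_long_run_covariance d' (T' : measurableType d')
    (P' : probability T' R) (X : int -> T' -> R) (F : R -> R)
    (G : T -> L1 R) :=
  forall f g, bounded_measurable f -> bounded_measurable g ->
    (\sum_(i < n.*2.+1)
       \int[P']_w \int[(lebesgue_measure \x lebesgue_measure)%E]_z
         (f z.1 * g z.2 * (((X 0 w <= z.1)%R)%:R - F z.1) *
          (((X (i%:Z - n%:Z) w <= z.2)%R)%:R - F z.2))%:E)%E
      @[n --> \oo] -->
    covariance P (fun w => \int[lebesgue_measure]_t (f t * G w t))
                 (fun w => \int[lebesgue_measure]_t (g t * G w t)).

Definition limit_statistic (G : T -> L1 R * L1 R) (w : T) : R :=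
  \int[lebesgue_measure]_t `|(G w).1 t - (G w).2 t|.

End limit_process.

Definition test_statistic d (T : measurableType d) (R : realType)
    (X Y : int -> T -> R) (n : nat) (w : T) : \bar R :=
  ((Num.sqrt n%:R)%:E *
   W1 (empirical_measure X n w) (empirical_measure Y n w))%E.

(* Main.v *)
(* On the real line, W1 of two empirical measures of the same size is the L1
   distance of their distribution functions: a coupling never does better, by
   Fubini applied to |x - y| = int |1{x <= t} - 1{y <= t}| dt, and the coupling
   that pairs the sorted samples attains it. The centering F cancels in the
   difference, so T_n = ||Y_n.1 - Y_n.2||_1 is a fixed Lipschitz functional of
   Y_n, the continuous mapping and portmanteau theorems apply at the non-atom q,
   and the limit P(Z > q) is alpha because P(Z <= q) = P(Z < q) lies on both
   sides of 1 - alpha. *)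

From HB Require Import structures.
Require Import Defs.
From mathcomp Require Import all_boot all_order all_algebra.
From mathcomp Require Import all_classical all_reals all_analysis.
From mathcomp Require Import measurable_realfun lra.

Set Implicit Arguments.
Unset Strict Implicit.
Unset Printing Implicit Defensive.

Import Order.TTheory GRing.Theory Num.Theory.
Import numFieldNormedType.Exports.

Local Open Scope classical_set_scope.
Local Open Scope ring_scope.

(** * Lower bound of transport costs by the L1 distance of distribution functions *)

Section wasserstein.
Context (R : realType).
Notation mu := (@lebesgue_measure R).

Definition cdf_gap (t : R) (z : R * R) : R :=
  (z.1 <= t)%R%:R - (z.2 <= t)%R%:R.

(** Joint measurability in the threshold and the pair is what Tonelli's theorem asks for below. *)
Lemma measurable_cdf_gap :
  measurable_fun setT (fun u : R * (R * R) => cdf_gap u.1 u.2).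
Proof.
have mle (f : R * (R * R) -> R) : measurable_fun setT f ->
    measurable_fun setT (fun u => (f u <= u.1)%R%:R : R).
  move=> mf; rewrite (_ : (fun u => _) = \1_[set u | f u <= u.1]); last first.
    by apply/funext => u; rewrite indicE mem_setE.
  apply: measurable_indic.
  by rewrite -[X in measurable X]setTI; apply: measurable_fun_le.
apply: measurable_funB; apply: mle.
- exact: (measurableT_comp measurable_fst measurable_snd).
- exact: (measurableT_comp measurable_snd measurable_snd).
Qed.

Lemma measurable_normr_cdf_gap :
  measurable_fun setT (fun u : R * (R * R) => `|cdf_gap u.1 u.2|%:E).
Proof.
apply/measurable_EFinP.
exact: (measurableT_comp (@normr_measurable R setT) measurable_cdf_gap).
Qed.

(** The gap has modulus 1 exactly for thresholds in the half-open interval between the two points,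
    whose length is their distance. *)
Lemma integral_cdf_gap (z : R * R) :
  (\int[mu]_t `|cdf_gap t z|%:E = `|z.1 - z.2|%:E)%E.
Proof.
wlog le_z : z / z.1 <= z.2.
  move=> H; case/orP: (le_total z.1 z.2) => [|le21]; first exact: H.
  rewrite distrC -(H (z.2, z.1))//=.
  by apply: eq_integral => t _; rewrite /cdf_gap distrC.
rewrite (_ : (fun t => _) = (fun t => (\1_`[z.1, z.2[%classic t)%:E)).
  rewrite integral_indic// setIT /= lebesgue_measure_itv/= lte_fin.
  rewrite distrC ger0_norm ?subr_ge0//.
  case: ltP => // le21; congr EFin; apply/esym/eqP; rewrite subr_eq0.
  by rewrite eq_le le21 le_z.
apply/funext => t; rewrite /cdf_gap indicE mem_setE in_itv/=.
have [le1|lt1] := leP z.1 t; have [le2|lt2] := leP z.2 t; congr EFin;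
  rewrite ?subrr ?normr0 ?subr0 ?normr1//.
by have := le_lt_trans (le_trans le_z le2) lt1; rewrite ltxx.
Qed.

(** Monotone functions are Borel; finiteness is there because [fine] sends infinite values to 0,
    which would break monotonicity. *)
Lemma measurable_fine_ray (m : {measure set R -> \bar R}) :
  (forall t : R, m `]-oo, t]%classic \is a fin_num) ->
  measurable_fun setT (fun t : R => fine (m `]-oo, t]%classic)).
Proof.
move=> mfin; apply: nondecreasing_measurable => // s t st.
rewrite fine_le// le_measure ?inE//.
by apply: subitvPr; rewrite bnd_simp.
Qed.

(** Under [pi] the gap at [t] has mean equal to the difference of the two distribution functions.
    Moving the modulus inside this mean and exchanging the integrals in [t] and [z] gives the cost.
    Finiteness of [m] and [n] on rays is inherited from [pi]. *)
Lemma le_integral_coupling (m n : {measure set R -> \bar R})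
    (pi : probability (R * R)%type R) : couplings m n pi ->
  (\int[mu]_t `|fine (m `]-oo, t]%classic) - fine (n `]-oo, t]%classic)|%:E
    <= \int[pi]_z `|z.1 - z.2|%:E)%E.
Proof.
move=> pimn.
have mgap t : measurable_fun setT (cdf_gap t).
  exact: (measurableT_comp measurable_cdf_gap (measurable_pair1 t)).
have m1 t : measurable (fst @^-1` `]-oo, t]%classic : set (R * R)).
  by rewrite -[X in measurable X]setTI; exact: measurable_fst.
have m2 t : measurable (snd @^-1` `]-oo, t]%classic : set (R * R)).
  by rewrite -[X in measurable X]setTI; exact: measurable_snd.
have cdf_gapE t : \int[pi]_z cdf_gap t z =
    fine (m `]-oo, t]%classic) - fine (n `]-oo, t]%classic).
  have [<- _] := pimn `]-oo, t]%classic (measurable_itv _).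
  have [_ <-] := pimn `]-oo, t]%classic (measurable_itv _).
  rewrite (_ : cdf_gap t = (\1_(fst @^-1` `]-oo, t]%classic) \-
      \1_(snd @^-1` `]-oo, t]%classic))); last first.
    apply/funext => z /=; rewrite /cdf_gap !indicE.
    by congr ((nat_of_bool _)%:R - (nat_of_bool _)%:R);
      apply/idP/idP; rewrite inE /= in_itv.
  rewrite RintegralB//=; last 2 first.
  - exact: integrable_indic.
  - exact: integrable_indic.
  by rewrite /Rintegral !integral_indic// !setIT.
rewrite [leRHS](eq_integral (fun z => \int[mu]_t `|cdf_gap t z|%:E)%E); last first.
  by move=> z _; rewrite integral_cdf_gap.
rewrite -(fubini_tonelli (m1 := mu) (m2 := pi)
  (fun u => `|cdf_gap u.1 u.2|%:E)) /=; last 2 first.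
- exact: measurable_normr_cdf_gap.
- by move=> u; rewrite lee_fin.
apply: ge0_le_integral => //=.
- apply/measurable_EFinP/(measurableT_comp (@normr_measurable R setT)).
  apply: measurable_funB.
  + apply: (@measurable_fine_ray m) => t.
    have [<- _] := pimn `]-oo, t]%classic (measurable_itv _).
    exact: (fin_num_measure pi).
  + apply: (@measurable_fine_ray n) => t.
    have [_ <-] := pimn `]-oo, t]%classic (measurable_itv _).
    exact: (fin_num_measure pi).
- exact: (@measurable_fun_fubini_tonelli_F _ _ _ _ _ pi
    (fun u => `|cdf_gap u.1 u.2|%:E) measurable_normr_cdf_gap).
move=> t _; rewrite -cdf_gapE.
(* The gap only takes the values -1, 0 and 1. *)
have int_gap : pi.-integrable setT (EFin \o cdf_gap t).
  apply: measurable_bounded_integrable => //.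
    by rewrite /= probability_setT ltry.
  exists 1; split => // M M1 z _ /=; rewrite /cdf_gap.
  rewrite (le_trans _ (ltW M1))//.
  by do 2 case: (_ <= t); rewrite ?subrr ?subr0 ?sub0r ?normrN ?normr0 ?normr1.
rewrite EFin_normr_Rintegral//.
by apply: le_abse_integral => //; exact/measurable_EFinP.
Qed.

End wasserstein.

(** * Optimality of the monotone coupling of two samples of equal size *)

Section uniform_points.
Context (R : realType).
Notation mu := (@lebesgue_measure R).

(** The space is arbitrary so that the same construction covers samples on the line and their
    couplings on the plane. *)
Definition uniform_points d (U : measurableType d) (n : nat) (a : nat -> U)
    : set U -> \bar R :=
  mscale (n%:R^-1 : R)%:nng (msum (fun k => \d_(a k)) n).

HB.instance Definition _ d (U : measurableType d) n (a : nat -> U) :=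
  Measure.on (uniform_points n a).

Lemma uniform_pointsE d (U : measurableType d) n (a : nat -> U) A :
  uniform_points n a A = (n%:R^-1 * \sum_(k < n) \1_A (a k))%:E.
Proof.
by rewrite /uniform_points/= /mscale/= /msum/= EFinM -sumEFin.
Qed.

Lemma uniform_points_perm d (U : measurableType d) n (a b : nat -> U) A :
  perm_eq (mkseq a n) (mkseq b n) ->
  uniform_points n a A = uniform_points n b A.
Proof.
move=> ab; rewrite !uniform_pointsE; congr (_ * _)%:E.
have sumE (c : nat -> U) : \sum_(k < n) \1_A (c k) =
    \sum_(x <- mkseq c n) (\1_A x : R).
  by rewrite /mkseq big_map -(big_mkord xpredT (fun k => \1_A (c k)))
    /index_iota subn0.
by rewrite !sumE; exact: perm_big.
Qed.

Section probability.
Context d (U : measurableType d) (n : nat) (a : nat -> U).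

(** The size is a successor because size zero gives the null measure. *)
Let uniform_points_setT : uniform_points n.+1 a setT = 1%E.
Proof.
rewrite uniform_pointsE; under eq_bigr do rewrite indicT.
by rewrite sumr_const card_ord mulVf.
Qed.

HB.instance Definition _ := Measure_isProbability.Build _ _ _
  (uniform_points n.+1 a) uniform_points_setT.

Definition uniform_prob : probability U R := uniform_points n.+1 a.

End probability.

Lemma integral_uniform_points d (U : measurableType d) n (a : nat -> U)
    (f : U -> R) : measurable_fun setT f -> (forall x, 0 <= f x) ->
  (\int[uniform_points n a]_x (f x)%:E =
    (n%:R^-1 * \sum_(k < n) f (a k))%:E)%E.
Proof.
move=> mf f0; have mf' : measurable_fun setT (EFin \o f).
  exact/measurable_EFinP.
rewrite ge0_integral_mscale//; last by move=> x _; rewrite lee_fin.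
rewrite ge0_integral_measure_sum//; last by move=> x _; rewrite lee_fin.
rewrite EFinM -sumEFin; congr (_ * _)%E; apply: eq_bigr => k _.
by rewrite integral_dirac// diracT mul1e.
Qed.

(** The default 0 is reached only at indices from [n] on, which no sum below involves. *)
Definition sorted_points (n : nat) (a : nat -> R) : nat -> R :=
  nth 0 (sort <=%O (mkseq a n)).

Lemma sorted_points_perm n a :
  perm_eq (mkseq (sorted_points n a) n) (mkseq a n).
Proof.
rewrite -{2}(size_mkseq a n) -(size_sort <=%O) mkseq_nth.
by rewrite perm_sort.
Qed.

Lemma le_sorted_points n a i j : (i <= j < n)%N ->
  sorted_points n a i <= sorted_points n a j.
Proof.
move=> /andP[ij jn]; apply: (sorted_leq_nth le_trans lexx) => //.
- exact/sort_sorted/le_total.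
- by rewrite inE size_sort size_mkseq (leq_ltn_trans ij).
- by rewrite inE size_sort size_mkseq.
Qed.

(* For a fixed threshold, the gaps of the pairs of a monotone coupling all
   have the same sign. *)
Lemma normr_sum_cdf_gap_sorted n a b (t : R) :
  `|\sum_(k < n) cdf_gap t (sorted_points n a k, sorted_points n b k)| =
  \sum_(k < n) `|cdf_gap t (sorted_points n a k, sorted_points n b k)|.
Proof.
pose g (k : nat) := cdf_gap t (sorted_points n a k, sorted_points n b k).
rewrite -[LHS]/(`|\sum_(k < n) g k|) -[RHS]/(\sum_(k < n) `|g k|).
have [/forallP g_ge0|/forallPn[k gk]] := boolP [forall k : 'I_n, 0 <= g k].
  rewrite ger0_norm; last by apply: sumr_ge0 => k _; exact: g_ge0.
  by apply: eq_bigr => k _; rewrite ger0_norm// g_ge0.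
suff g_le0 (l : 'I_n) : g l <= 0.
  rewrite ler0_norm; last by apply: sumr_le0 => l _; exact: g_le0.
  rewrite -sumrN.
  by apply: eq_bigr => l _; rewrite ler0_norm// g_le0.
(* A positive gap at [l] means that the [l]-th point of [a] is at most [t] and that of [b] exceeds
   [t]. By sorting, the first fact passes to [k <= l] and the second to [k >= l]; either one makes
   the gap at [k] nonnegative. *)
rewrite leNgt; apply: contra gk; rewrite /g /cdf_gap/=.
have [al|] := leP (sorted_points n a l) t;
  have [|bl] := leP (sorted_points n b l) t;
  rewrite ?subrr ?subr0 ?sub0r ?ltxx ?oppr_gt0 ?ltr10 ?ltr01// => _.
have [kl|/ltnW lk] := leqP k l.
  rewrite (le_trans (le_sorted_points a _) al) ?kl ?ltn_ord//.
  by rewrite subr_ge0 ler_nat leq_b1.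
rewrite [X in _ - (nat_of_bool X)%:R](_ : _ = false) ?subr0 ?ler0n//.
apply/negbTE; rewrite -ltNge (lt_le_trans bl)// le_sorted_points//.
by rewrite lk ltn_ord.
Qed.

(** Couplings see the marginals only through their values on sets; this allows passing between
    different measure structures on the same set function. *)
Lemma W1_ext (m m' n n' : {measure set R -> \bar R}) :
  (forall A, m A = m' A) -> (forall A, n A = n' A) -> W1 m n = W1 m' n'.
Proof.
move=> mm' nn'; rewrite /W1; congr ereal_inf; congr image.
by apply/seteqP; split => pi H A mA; have := H A mA; rewrite mm' nn'.
Qed.

(** One inequality holds for every coupling; for the other, the uniform law on the pairs of sorted
    points turns the general bound into an equality. *)
Lemma W1_uniform_points n (a b : nat -> R) :
  (W1 (uniform_points n.+1 a) (uniform_points n.+1 b) =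
  \int[mu]_t `|fine (uniform_points n.+1 a `]-oo, t]%classic) -
               fine (uniform_points n.+1 b `]-oo, t]%classic)|%:E)%E.
Proof.
apply/eqP; rewrite eq_le; apply/andP; split; last first.
  by apply: le_ereal_inf_tmp => _ [pi /le_integral_coupling ? <-].
set a' := sorted_points n.+1 a; set b' := sorted_points n.+1 b.
pose z k := (a' k, b' k).
have aE A : uniform_points n.+1 a A = uniform_points n.+1 a' A.
  by apply: uniform_points_perm; rewrite perm_sym sorted_points_perm.
have bE A : uniform_points n.+1 b A = uniform_points n.+1 b' A.
  by apply: uniform_points_perm; rewrite perm_sym sorted_points_perm.
apply: ge_ereal_inf; exists (\int[uniform_prob n z]_z `|z.1 - z.2|%:E)%E.
  exists (uniform_prob n z) => // A mA; split.
  - by rewrite /= aE !uniform_pointsE.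
  - by rewrite /= bE !uniform_pointsE.
rewrite integral_uniform_points//; last first.
  apply: measurableT_comp => //; apply: measurable_funB.
  - exact: measurable_fst.
  - exact: measurable_snd.
rewrite EFinM -sumEFin.
(* Each distance becomes an integral over thresholds, so that the comparison can be made for each
   [t] separately. *)
under eq_bigr do rewrite -integral_cdf_gap.
have mg k : measurable_fun setT (fun t => `|cdf_gap t (z k)|%:E).
  exact: (measurableT_comp (@measurable_normr_cdf_gap R) (measurable_pair2 (z k))).
rewrite -ge0_integral_sum//; last by move=> k; exact: mg.
rewrite -ge0_integralZl//; last 2 first.
- by apply: emeasurable_sum => k; exact: mg.
- by move=> t _; apply: sume_ge0 => k _; rewrite lee_fin.
rewrite le_eqVlt; apply/orP; left; apply/eqP; apply: eq_integral => t _.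
(* Since the gaps at [t] share one sign, the sum of moduli is the modulus of the sum. *)
rewrite sumEFin -EFinM -normr_sum_cdf_gap_sorted aE bE !uniform_pointsE/=.
rewrite -mulrBr normrM ger0_norm// -sumrB; congr (_ * `|_|)%:E.
by apply: eq_bigr => k _; rewrite /cdf_gap !indicE !mem_setE !in_itv.
Qed.

End uniform_points.

(** * Tail probability beyond a quantile that is not an atom *)

Section quantile.
Context d (T : measurableType d) (R : realType) (P : probability T R).

Lemma cvge_near_lt (I : Type) (F : set_system I) (FF : Filter F)
    (f : I -> \bar R) (l c : \bar R) :
  f @ F --> l -> (l < c)%E -> \forall x \near F, (f x < c)%E.
Proof.
move=> fl lc; apply: (fl [set y | (y < c)%E]).
by apply: open_nbhs_nbhs; split; [exact: open_ereal_lt_ereal|].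
Qed.

Lemma cvge_near_gt (I : Type) (F : set_system I) (FF : Filter F)
    (f : I -> \bar R) (l c : \bar R) :
  f @ F --> l -> (c < l)%E -> \forall x \near F, (c < f x)%E.
Proof.
move=> fl lc; apply: (fl [set y | (c < y)%E]).
by apply: open_nbhs_nbhs; split; [exact: open_ereal_gt_ereal|].
Qed.

Lemma measurable_continuous_borel (S : ptopologicalType) (f : S -> R) :
  continuous f -> measurable_fun [set: borel S] f.
Proof.
move=> /continuousP cf.
apply: (measurability _ (RGenOpens.measurableE R)) => _ [_ [a [b ->] <-]].
by rewrite setTI; apply: sub_sigma_algebra; exact/cf/interval_open.
Qed.

Lemma cdfE (Z : {RV P >-> R}) x : cdf Z x = P [set w | Z w <= x].
Proof.
by rewrite /cdf /distribution/= /pushforward; congr (P _);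
  apply/seteqP; split => w /=;
  rewrite in_itv.
Qed.

Lemma ccdfE (Z : {RV P >-> R}) x : ccdf Z x = P [set w | x < Z w].
Proof.
by rewrite /ccdf /distribution/= /pushforward; congr (P _);
  apply/seteqP; split => w /=;
  rewrite in_itv /= andbT.
Qed.

Lemma measurable_le_cst (Z : {RV P >-> R}) x : measurable [set w | Z w <= x].
Proof. by rewrite -[X in measurable X]setTI; apply: measurable_fun_le. Qed.

Lemma measurable_gt_cst (Z : {RV P >-> R}) x : measurable [set w | x < Z w].
Proof.
rewrite (_ : mkset _ = Z @^-1` `]x, +oo[%classic); first exact: measurable_funPTI.
by apply/seteqP; split => w /=; rewrite in_itv /= andbT.
Qed.

Lemma measurable_ge_cst (Z : {RV P >-> R}) x : measurable [set w | x <= Z w].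
Proof. by rewrite -[X in measurable X]setTI; apply: measurable_fun_le. Qed.

(** This is left-continuity of the closed tail at [x], obtained from right-continuity of the
    distribution function of [- Z]; hence the reflected variable [y]. *)
Lemma cvg_prob_ge (Z : {RV P >-> R}) x :
  P [set w | (- y <= Z w)%R] @[y --> (- x)^'+] --> P [set w | (x <= Z w)%R].
Proof.
pose Z' : {RV P >-> R} := \- Z.
have Z'E y : P [set w | - y <= Z w] = cdf Z' y.
  by rewrite cdfE; congr (P _); apply/seteqP; split => w /=; rewrite lerNl.
rewrite -{2}(opprK x) Z'E (eq_cvg _ _ Z'E).
exact: cdf_right_continuous.
Qed.

Lemma prob_gt_ge (Z : {RV P >-> R}) x : P [set w | Z w = x] = 0%E ->
  P [set w | x <= Z w] = P [set w | x < Z w].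
Proof.
move=> Zx; rewrite (_ : [set w | x <= Z w] =
     [set w | x < Z w] `|` [set w | Z w = x]).
  rewrite measureU0//; first exact: measurable_gt_cst.
  rewrite (_ : [set w | Z w = x] = [set w | Z w <= x] `&` [set w | x <= Z w]).
    by apply: measurableI; [exact: measurable_le_cst|exact: measurable_ge_cst].
  apply/seteqP; split => w /= => [->//|[wx xw]].
  by apply/eqP; rewrite eq_le wx xw.
apply/seteqP; split => w /=.
  by rewrite le_eqVlt => /orP[/eqP|]; [right|left].
by case=> [/ltW//|->].
Qed.

(** At the quantile the distribution function is at least [p] and the closed tail at least [1 - p].
    Without an atom the closed and open tails agree, which pinches the value. *)
Lemma ccdf_quantile (Z : {RV P >-> R}) (p : R) : 0 < p < 1 ->
  P [set w | Z w = quantile P Z p] = 0%E ->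
  P [set w | quantile P Z p < Z w] = (1 - p)%:E.
Proof.
move=> /andP[p0 p1] /prob_gt_ge; rewrite /quantile.
set E := [set x : R | (p%:E <= _)%E]; set q := inf E => geq.
have EP x : E x <-> (p%:E <= cdf Z x)%E by rewrite cdfE.
(* The limits 0 and 1 of the distribution function make [E] bounded below and nonempty, so that
   [inf] is a true infimum. *)
have E_lb : has_lbound E.
  have : \forall x \near -oo, (cdf Z x < p%:E)%E.
    by apply: cvge_near_lt; [exact: cvg_cdfNy0|rewrite lte_fin].
  move=> /filter_ex[x xp]; exists x => y /EP py.
  rewrite leNgt; apply/negP => /ltW/(cdf_nondecreasing Z).
  by apply/negP; rewrite -ltNge (lt_le_trans xp).
have E_nonempty : E !=set0.
  have : \forall x \near +oo, (p%:E < cdf Z x)%E.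
    by apply: cvge_near_gt; [exact: cvg_cdfy1|rewrite lte_fin].
  by move=> /filter_ex[x xp]; exists x; apply/EP/ltW.
(* Every [x > q] lies above a point of [E]; right-continuity carries the bound down to [q]. *)
have q_le : (p%:E <= cdf Z q)%E.
  apply: (cvge_to_ge (@cdf_right_continuous _ _ _ _ Z q)).
  near=> x.
  have qx : q < x by near: x; exact: nbhs_right_gt.
  have [|y /EP py] := @inf_adherent _ E (x - q) _ (conj E_nonempty E_lb).
    by rewrite subr_gt0.
  by rewrite subrKC => /ltW/(cdf_nondecreasing Z); exact: le_trans.
(* Points [- y < q] are outside [E], so their tails are at least [1 - p]; then [- y] increases to
   [q]. *)
have q_ge : ((1 - p)%:E <= P [set w | (q <= Z w)%R])%E.
  apply: (cvge_to_ge (@cvg_prob_ge Z q)).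
  near=> y.
  have yq : - y < q.
    by rewrite ltrNl; near: y; exact: nbhs_right_gt.
  have : ~ E (- y) by move=> /(ge_inf E_lb); apply/negP; rewrite -ltNge.
  rewrite EP => /negP; rewrite -ltNge cdf_1_ccdf => yp.
  apply: (@le_trans _ _ (ccdf Z (- y))).
    rewrite EFinB leeBlDr// addeC -leeBlDr//; last exact: fin_num_measure.
    exact: ltW.
  rewrite ccdfE le_measure ?inE//.
  - exact: measurable_gt_cst.
  - exact: measurable_ge_cst.
  - by move=> w /= /ltW.
rewrite -ccdfE in geq *; apply/eqP; rewrite eq_le; apply/andP; split.
  by rewrite ccdf_1_cdf EFinB leeB.
by rewrite -geq.
Unshelve. all: by end_near. Qed.
End quantile.

(** * Continuous approximations of indicators of half-lines *)

Section ramp.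
Context (R : realType).

(** For [a < b] it lies between the indicators of [x > b] and [x > a], and so is a test function for
    tail probabilities. *)
Definition ramp (a b x : R) : R := Num.max 0 (Num.min 1 ((x - a) / (b - a))).

Lemma ramp_ge0 a b x : 0 <= ramp a b x.
Proof. by rewrite /ramp le_max lexx. Qed.

Lemma ramp_le1 a b x : ramp a b x <= 1.
Proof. by rewrite /ramp ge_max ler01 ge_min lexx. Qed.

Lemma ramp_eq0 a b x : a < b -> x <= a -> ramp a b x = 0.
Proof.
move=> ab xa; apply/max_idPl; rewrite ge_min; apply/orP; right.
by rewrite mulr_le0_ge0 ?subr_le0// invr_ge0 subr_ge0 ltW.
Qed.

Lemma ramp_eq1 a b x : a < b -> b <= x -> ramp a b x = 1.
Proof.
move=> ab bx; rewrite /ramp; have /min_idPl -> : 1 <= (x - a) / (b - a).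
  by rewrite ler_pdivlMr ?subr_gt0// mul1r lerD2r.
by apply/max_idPr.
Qed.

Lemma continuous_ramp a b : continuous (ramp a b).
Proof.
rewrite (_ : ramp a b = (cst 0 : R -> R^o) \max
  ((cst 1 : R -> R^o) \min (fun x => (x - a) / (b - a)))) // => x.
apply: continuous_max; first exact: cvg_cst.
apply: continuous_min; first exact: cvg_cst.
by apply: cvgMl; apply: cvgB; [exact: cvg_id|exact: cvg_cst].
Qed.

End ramp.

(** * Continuous mapping and portmanteau for tail events *)

Section convergence_in_distribution.
Context (R : realType).

Lemma expectation_ramp_ge d (T : measurableType d) (P : probability T R)
    (Z : {RV P >-> R}) a b : a < b ->
  (P [set w | (b < Z w)%R] <= 'E_P[ramp a b \o Z])%E.
Proof.
move=> ab; rewrite -expectation_indic; last exact: measurable_gt_cst.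
apply: expectation_le => //.
- exact/measurable_indic/measurable_gt_cst.
- by apply: measurableT_comp => //;
    exact: (continuous_measurable_fun (@continuous_ramp R a b)).
- by move=> w; exact: ramp_ge0.
- apply: aeW => w; rewrite indicE; have [/[!inE]/= bZ|_] := boolP (w \in _).
    by rewrite ramp_eq1// ltW.
  exact: ramp_ge0.
Qed.

Lemma expectation_ramp_le d (T : measurableType d) (P : probability T R)
    (Z : {RV P >-> R}) a b : a < b ->
  ('E_P[ramp a b \o Z] <= P [set w | (a < Z w)%R])%E.
Proof.
move=> ab; rewrite -expectation_indic; last exact: measurable_gt_cst.
apply: expectation_le => //.
- by apply: measurableT_comp => //;
    exact: (continuous_measurable_fun (@continuous_ramp R a b)).
- exact/measurable_indic/measurable_gt_cst.
- by move=> w; exact: ramp_ge0.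
- apply: aeW => w; rewrite indicE; have [_|] := boolP (w \in _).
    exact: ramp_le1.
  by rewrite notin_setE/= => /negP; rewrite -leNgt => ?; rewrite ramp_eq0.
Qed.

(** The tail at [q] is squeezed between expectations of a ramp rising just after [q] and one rising
    just before it. These expectations converge, and their limits are close to the limiting tail
    because [q] is not an atom. *)
Lemma cvg_in_distribution_gt d d' (T : measurableType d)
    (T' : measurableType d') (P : probability T R) (P' : probability T' R)
    (S : ptopologicalType) (X : nat -> {RV P >-> borel S})
    (Y : {RV P' >-> borel S}) (phi : S -> R) (q : R) :
  continuous phi -> cvg_in_distribution X Y ->
  P' [set w | phi (Y w) = q] = 0%E ->
  P [set w | (q < phi (X n w))%R] @[n --> \oo] --> P' [set w | (q < phi (Y w))%R].
Proof.
move=> cphi XY Yq.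
have mphi := measurable_continuous_borel cphi.
have mX n : measurable_fun setT (phi \o X n) by exact: measurableT_comp.
have mY : measurable_fun setT (phi \o Y) by exact: measurableT_comp.
pose U n : {RV P >-> R} := mfun_Sub (mem_set (mX n)).
pose V : {RV P' >-> R} := mfun_Sub (mem_set mY).
(* A ramp composed with [phi] is bounded and continuous on [S], hence admissible as a test
   function. *)
have UV a b : ('E_P[ramp a b \o U n] @[n --> \oo] --> 'E_P'[ramp a b \o V])%E.
  apply: (XY (ramp a b \o phi)).
    by move=> x; apply: continuous_comp; [exact: cphi|exact: continuous_ramp].
  by exists 1 => x; rewrite ger0_norm ?ramp_ge0// ramp_le1.
have Vq : P' [set w | (q <= V w)%R] = P' [set w | (q < V w)%R].
  exact: prob_gt_ge.
have fin_V : P' [set w | (q < V w)%R] \is a fin_num.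
  by apply: fin_num_measure; exact: measurable_gt_cst.
have fin_U n : P [set w | (q < U n w)%R] \is a fin_num.
  by apply: fin_num_measure; exact: measurable_gt_cst.
rewrite -[X in _ --> X](fineK fin_V); apply: cvg_EFin; first exact: nearW.
apply/cvgrPdist_le => e e0.
have [b qb Vb] : exists2 b, q < b &
    (P' [set w | (q < V w)%R] - e%:E < P' [set w | (b < V w)%R])%E.
  have : \forall b \near q^'+, (P' [set w | (q < V w)%R] - e%:E < ccdf V b)%E.
    apply: cvge_near_gt; first exact: (@ccdf_right_continuous _ _ _ _ V q).
    by rewrite ccdfE lteBlDr// lteDl// lte_fin.
  move=> Vb; have [b [qb Vqb]] := filter_ex (filterI (nbhs_right_gt q) Vb).
  by exists b => //; rewrite -(ccdfE V b).
(* From the left of [q] the tails tend to the closed tail at [q]; this is the place where the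
   absence of an atom enters. *)
have [a aq Va] : exists2 a, a < q &
    (P' [set w | (a < V w)%R] < P' [set w | (q < V w)%R] + e%:E)%E.
  have : \forall y \near (- q)^'+,
      (P' [set w | (- y <= V w)%R] < P' [set w | (q < V w)%R] + e%:E)%E.
    apply: cvge_near_lt; first exact: (@cvg_prob_ge _ _ _ _ V q).
    by rewrite Vq lteDl// lte_fin.
  move=> Va; have [y [qy Vy]] := filter_ex (filterI (nbhs_right_gt (- q)) Va).
  exists (- y); first by rewrite ltrNl.
  apply: le_lt_trans Vy; rewrite le_measure ?inE//.
  - exact: measurable_gt_cst.
  - exact: measurable_ge_cst.
  - by move=> w /= /ltW.
have near_b : \forall n \near \oo,
    (P' [set w | (q < V w)%R] - e%:E < 'E_P[ramp q b \o U n])%E.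
  apply: cvge_near_gt; first exact: UV.
  exact: lt_le_trans Vb (expectation_ramp_ge _ _).
have near_a : \forall n \near \oo,
    ('E_P[ramp a q \o U n] < P' [set w | (q < V w)%R] + e%:E)%E.
  apply: cvge_near_lt; first exact: UV.
  exact: le_lt_trans (expectation_ramp_le _ _) Va.
near=> n.
have lo : (P' [set w | (q < V w)%R] - e%:E < P [set w | (q < U n w)%R])%E.
  by apply: (@lt_le_trans _ _ ('E_P[ramp q b \o U n])%E);
    [near: n|exact: expectation_ramp_le].
have hi : (P [set w | (q < U n w)%R] < P' [set w | (q < V w)%R] + e%:E)%E.
  by apply: (@le_lt_trans _ _ ('E_P[ramp a q \o U n])%E);
    [exact: expectation_ramp_ge|near: n].
rewrite ler_distlC /=.
rewrite -(fineK fin_V) -(fineK (fin_U n)) in lo hi.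
rewrite -EFinB lte_fin in lo; rewrite -EFinD lte_fin in hi.
by rewrite (ltW lo) (ltW hi).
Unshelve. all: by end_near. Qed.

End convergence_in_distribution.

(** * The L1 distance as a continuous functional on pairs *)

Section L1_distance.
Context (R : realType).
Notation mu := (@lebesgue_measure R).

Definition L1dist (u : L1 R * L1 R) : R :=
  \int[mu]_t `|u.1 t - u.2 t|.

Lemma L1distE (u : L1 R * L1 R) : L1dist u = LfunPseudoMetric.Ldist u.1 u.2.
Proof.
by rewrite /L1dist /LfunPseudoMetric.Ldist Lnorm1.
Qed.

Lemma continuous_L1dist : continuous L1dist.
Proof.
move=> u; apply/cvgrPdist_le => e e0.
have e2 : 0 < e / 2 by rewrite divr_gt0.
have near1 : \forall v \near u, LfunPseudoMetric.Ldist u.1 v.1 < e / 2.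
  exists (ball u.1 (e / 2), setT); last by case=> v1 v2 [].
  by split; [exact: nbhsx_ballx|exact: filterT].
have near2 : \forall v \near u, LfunPseudoMetric.Ldist u.2 v.2 < e / 2.
  exists (setT, ball u.2 (e / 2)); last by case=> v1 v2 [].
  by split; [exact: filterT|exact: nbhsx_ballx].
near=> v.
have Ldist_triangle (f g h : L1 R) : LfunPseudoMetric.Ldist f h <=
    LfunPseudoMetric.Ldist f g + LfunPseudoMetric.Ldist g h.
  by rewrite /LfunPseudoMetric.Ldist -{1}[f](subrK g) -addrA ler_LnormD.
have Ldist_sym (f g : L1 R) :
    LfunPseudoMetric.Ldist f g = LfunPseudoMetric.Ldist g f.
  by rewrite /LfunPseudoMetric.Ldist -(LnormrN (g - f)) -(opprB g f).
have uv1 : LfunPseudoMetric.Ldist u.1 v.1 < e / 2 by near: v.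
have uv2 : LfunPseudoMetric.Ldist u.2 v.2 < e / 2 by near: v.
(* Passing from [u] to [v] one coordinate at a time, in both directions, changes the distance by
   less than [e / 2 + e / 2]. *)
have t1 := Ldist_triangle u.1 v.1 u.2; have t2 := Ldist_triangle v.1 v.2 u.2.
have t3 := Ldist_triangle v.1 u.1 v.2; have t4 := Ldist_triangle u.1 u.2 v.2.
have s1 := Ldist_sym v.1 u.1; have s2 := Ldist_sym v.2 u.2.
rewrite !L1distE ler_distlC.
move: uv1 uv2 t1 t2 t3 t4 s1 s2.
move: (LfunPseudoMetric.Ldist u.1 v.1) (LfunPseudoMetric.Ldist u.2 v.2)
  (LfunPseudoMetric.Ldist u.1 u.2) (LfunPseudoMetric.Ldist v.1 v.2)
  (LfunPseudoMetric.Ldist v.1 u.1) (LfunPseudoMetric.Ldist v.2 u.2)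
  (LfunPseudoMetric.Ldist v.1 u.2) (LfunPseudoMetric.Ldist u.1 v.2).
move=> ? ? ? ? ? ? ? ? ? ? ? ? ? ? ? ?; apply/andP; split; lra.
Unshelve. all: by end_near. Qed.

(** The difference of two integrable functions has finite norm, so the extended integral loses
    nothing under [fine]. *)
Lemma integral_L1dist (u : L1 R * L1 R) :
  (\int[mu]_t `|u.1 t - u.2 t|%:E = (L1dist u)%:E)%E.
Proof.
have := finite_norm_fine (u.1 - u.2).
by rewrite L1distE /LfunPseudoMetric.Ldist => ->; rewrite Lnorm1.
Qed.

End L1_distance.

(** * The test statistic as a functional of the empirical processes *)

Lemma empirical_measureE d (T : measurableType d) (R : realType)
    (X : int -> T -> R) n w A :
  empirical_measure X n w A = uniform_points R n (fun k => X k.+1%:Z w) A.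
Proof. by []. Qed.

(** The centering [F] cancels in [u.1 - u.2], and the factor [Num.sqrt n.+1%:R] moves into the
    integral that computes [W1]. *)
Lemma test_statistic_L1dist d (T : measurableType d) (R : realType)
    (X X' : int -> T -> R) (F : R -> R) n w (u : L1 R * L1 R) :
  (forall t, u.1 t = Num.sqrt n.+1%:R * (empirical_cdf X n.+1 w t - F t)) ->
  (forall t, u.2 t = Num.sqrt n.+1%:R * (empirical_cdf X' n.+1 w t - F t)) ->
  test_statistic X X' n.+1 w = (L1dist u)%:E.
Proof.
move=> u1 u2; rewrite /test_statistic.
rewrite (W1_ext (empirical_measureE X n.+1 w) (empirical_measureE X' n.+1 w)).
rewrite W1_uniform_points -integral_L1dist -ge0_integralZl//; last first.
  apply/measurable_EFinP/(measurableT_comp (@normr_measurable R setT)).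
  by apply: measurable_funB; apply: (@measurable_fine_ray R (uniform_points R n.+1 _))
    => t; rewrite /= uniform_pointsE.
apply: eq_integral => t _; rewrite u1 u2 -EFinM; congr EFin.
by rewrite -mulrBr opprB addrA subrK normrM ger0_norm// sqrtr_ge0.
Qed.

Theorem proposition4 (R : realType) (d d' : measure_display)
    (T : measurableType d) (T' : measurableType d')
    (P : probability T R) (P' : probability T' R)
    (Xi Xj : int -> {RV P >-> R}) (F : R -> R)
    (Xi_stationary : stationary P Xi) (Xi_ergodic : ergodic P Xi)
    (Xj_stationary : stationary P Xj) (Xj_ergodic : ergodic P Xj)
    (X_independent : independent_elements P (trajectory Xi) (trajectory Xj))
    (Xi_cdf : forall k t, cdf (Xi k) t = (F t)%:E)
    (Xj_cdf : forall k t, cdf (Xj k) t = (F t)%:E)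
    (Y : nat -> {RV P >-> borel (L1 R * L1 R)%type})
    (Y_i : forall n w (t : R),
       (Y n w).1 t = Num.sqrt n%:R * (empirical_cdf Xi n w t - F t))
    (Y_j : forall n w (t : R),
       (Y n w).2 t = Num.sqrt n%:R * (empirical_cdf Xj n w t - F t))
    (G : {RV P' >-> borel (L1 R * L1 R)%type})
    (Y_cvg : cvg_in_distribution Y G)
    (G_gaussian : centered_gaussian P' G)
    (G_independent : independent_elements P'
       (fun w => (G w).1 : borel (L1 R)) (fun w => (G w).2 : borel (L1 R)))
    (G_same_law : identically_distributed P'
       (fun w => (G w).1 : borel (L1 R)) (fun w => (G w).2 : borel (L1 R)))
    (Gi_covariance : has_long_run_covariance P' P Xi F (fun w => (G w).1))
    (Gj_covariance : has_long_run_covariance P' P Xj F (fun w => (G w).2))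
    (alpha : R) (alpha_in : 0 < alpha < 1)
    (q : R) (q_def : q = quantile P' (limit_statistic G) (1 - alpha))
    (q_no_atom : P' [set w | limit_statistic G w = q] = 0%E) :
  P [set w | (q%:E < test_statistic Xi Xj n w)%E] @[n --> \oo] --> alpha%:E.
Proof.
have mZ : measurable_fun setT (limit_statistic G).
  have mL1dist : measurable_fun [set: borel (L1 R * L1 R)%type] (@L1dist R).
    exact: (measurable_continuous_borel (@continuous_L1dist R)).
  have mG : measurable_fun setT G by [].
  exact: (measurableT_comp mL1dist mG).
pose Z : {RV P' >-> R} := mfun_Sub (mem_set mZ).
(* The level is the tail of the limit beyond its quantile of order [1 - alpha], written
   [1 - (1 - alpha)]. *)
have <- : P' [set w | (q < limit_statistic G w)%R] = alpha%:E.
  rewrite -[alpha in RHS](subKr 1) q_def; apply: (@ccdf_quantile _ _ _ _ Z).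
    by rewrite subr_gt0 gtrBl andbC.
  by rewrite -q_def.
have := cvg_in_distribution_gt (@continuous_L1dist R) Y_cvg q_no_atom.
(* The statistic is identified with the L1 distance from sample size 1 on, which suffices for the
   limit. *)
apply: cvg_trans; apply: near_eq_cvg; exists 1%N => // -[//|n] _ /=.
congr (P _); apply/seteqP; split=> w /=;
  by rewrite (@test_statistic_L1dist _ _ _ _ _ F n w (Y n.+1 w)).
Qed.
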